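(* Let $B=(\ell,\varrho,Y)\in\mathcal B=[-1,1]\times\,]0,\infty[\,\times\,\mathbb R$. Any lightlike geodesic of Gödel's universe having impact parameter $B$, parametrised by a suitable affine parameter $\tau$ as $(x_\tau,y_\tau,z_\tau,t_\tau)$, satisfies, for some additional parameter $(Z_0,T_0)\in\mathbb R^2$ and for any real $\tau$: $$e^{-\sqrt2\,\omega x_\tau}=\frac2\varrho\left(1-\frac{2\sqrt{1-\ell^2}\,\big(\sqrt{1+\ell^2}\,\tan\tau+\sqrt{1-\ell^2}\big)}{2+\big(\sqrt{1+\ell^2}\,\tan\tau+\sqrt{1-\ell^2}\big)^2}\right);$$ $$y_\tau=Y+\frac{\sqrt{2(1-\ell^2)}}{\omega\varrho}\left(1-\frac{4}{2+\big(\sqrt{1+\ell^2}\,\tan\tau+\sqrt{1-\ell^2}\big)^2}\right);$$ $$z_\tau=Z_0+\frac{\ell\,\tau}{\omega\sqrt{(1+\ell^2)/2}};$$ $$t_\tau=T_0-\frac{\tau}{\omega\sqrt{(1+\ell^2)/2}}+\frac2\omega\,\mathrm{Arctan}\Big(\sqrt{(1+\ell^2)/2}\,\tan\tau+\sqrt{(1-\ell^2)/2}\Big);$$ $$\Big[\frac\varrho2\,e^{-\sqrt2\,\omega x_\tau}-1\Big]^2+\Big[\frac{\omega\varrho}{2}\,(y_\tau-Y)\Big]^2=\frac{1-\ell^2}{2}.$$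
   Context: Fix $\omega>0$. Gödel's universe is $\mathbb R^4$ with coordinates $(t,x,y,z)$ and the pseudo-metric $$ds^2=dt^2-dx^2+\tfrac12 e^{2\sqrt2\,\omega x}dy^2+2e^{\sqrt2\,\omega x}dt\,dy-dz^2 .$$ Along a (non-constant) lightlike geodesic with affine parameter (defined only up to an affine change $s\mapsto us+v$, $u\neq0$), the quantities $a=\dot t+e^{\sqrt2\omega x}\dot y$, $b=e^{\sqrt2\omega x}(2\dot t+e^{\sqrt2\omega x}\dot y)$, $c=\dot z$ and $Y=y+\frac{\sqrt2\,\dot x}{\omega b}$ are constant, with $ab>0$ and $c^2\le a^2$. Its impact parameter is $B=(\ell,\varrho,Y):=(c/a,\,b/a,\,Y)\in\mathcal B=[-1,1]\times\,]0,\infty[\,\times\,\mathbb R$, which does not depend on the choice of affine parameter. In the formulas, values at $\tau\in\frac\pi2+\pi\mathbb Z$ are understood by continuity, and in the formula for $t_\tau$ the successive determinations of $\mathrm{Arctan}$ are chosen so that $\tau\mapsto t_\tau$ is continuous. *)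

(* Defs.v *)
From HB Require Import structures.
From mathcomp Require Import all_boot all_order all_algebra.
From mathcomp Require Import all_classical all_reals all_analysis.

Set Implicit Arguments.
Unset Strict Implicit.
Unset Printing Implicit Defensive.

Import Order.TTheory GRing.Theory Num.Theory.
Import numFieldNormedType.Exports.

Local Open Scope classical_set_scope.
Local Open Scope ring_scope.

Section PseudoRiemannian.
Context {R : realType} {n : nat}.

Implicit Types (g : 'rV[R]_n.+1 -> 'M[R]_n.+1) (p : 'rV[R]_n.+1).
Implicit Types (gamma : R -> 'rV[R]_n.+1) (I : set R) (s : R).

Definition partial (f : 'rV[R]_n.+1 -> R) (i : 'I_n.+1) (p : 'rV[R]_n.+1) : R :=
  'D_(delta_mx ord0 i) f p.

(* Gamma^k_{ij} of the Levi-Civita connection of the (pseudo-)metric g. *)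
Definition christoffel g p (k i j : 'I_n.+1) : R :=
  2^-1 * \sum_(l < n.+1) invmx (g p) k l *
    (partial (fun q => g q l j) i p + partial (fun q => g q l i) j p
     - partial (fun q => g q i j) l p).

Definition velocity gamma s : 'rV[R]_n.+1 :=
  \row_i (fun r => gamma r ord0 i)^`()%classic s.

Definition derivable_on I gamma : Prop :=
  forall s, I s -> forall i, derivable (fun r => gamma r ord0 i) s 1.

(* I is an open interval, possibly unbounded. *)
Definition geodesic g I gamma : Prop :=
  [/\ open I, is_interval I, I !=set0,
      derivable_on I gamma /\ derivable_on I (velocity gamma)
    & forall s, I s -> forall k,
        velocity (velocity gamma) s ord0 k
        + \sum_(i < n.+1) \sum_(j < n.+1)
            christoffel g (gamma s) k i j
            * velocity gamma s ord0 i * velocity gamma s ord0 j = 0].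

(* A geodesic that is not the restriction of one on a larger interval. *)
Definition maximal_geodesic g I gamma : Prop :=
  geodesic g I gamma /\
  forall J delta, geodesic g J delta -> I `<=` J ->
    (forall s, I s -> delta s = gamma s) -> J `<=` I.

Definition lightlike_geodesic g I gamma : Prop :=
  geodesic g I gamma /\
  forall s, I s ->
    velocity gamma s != 0 /\
    \sum_(i < n.+1) \sum_(j < n.+1)
      g (gamma s) i j * velocity gamma s ord0 i * velocity gamma s ord0 j = 0.

End PseudoRiemannian.

Section Goedel.
Context {R : realType}.

Definition t_ : 'I_4 := @Ordinal 4 0 isT.
Definition x_ : 'I_4 := @Ordinal 4 1 isT.
Definition y_ : 'I_4 := @Ordinal 4 2 isT.
Definition z_ : 'I_4 := @Ordinal 4 3 isT.

Definition goedel_exp (omega : R) (p : 'rV[R]_4) : R :=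
  expR (Num.sqrt 2 * omega * p ord0 x_).

(* The cross term 2 e^{sqrt 2 omega x} dt dy is split evenly between the
   entries (t,y) and (y,t). *)
Definition goedel_metric (omega : R) (p : 'rV[R]_4) : 'M[R]_4 :=
  let E := goedel_exp omega p in
  \matrix_(i, j) nth 0 (nth [::]
    [:: [:: 1; 0;  E;           0];
        [:: 0; -1; 0;           0];
        [:: E; 0;  2^-1 * E ^+ 2; 0];
        [:: 0; 0;  0;           -1]] i) j.

(* (ell, rho, Y), read off at the parameter s.  The quantities a, b, c, Y are
   constant along a geodesic, so that the choice of s is immaterial. *)
Definition impact_parameter (omega : R) (gamma : R -> 'rV[R]_4) (s : R)
    : R * R * R :=
  let E := goedel_exp omega (gamma s) in
  let v := velocity gamma s in
  let a := v ord0 t_ + E * v ord0 y_ in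
  let b := E * (2 * v ord0 t_ + E * v ord0 y_) in
  let c := v ord0 z_ in
  (c / a, b / a,
   gamma s ord0 y_ + Num.sqrt 2 * v ord0 x_ / (omega * b)).

(* w is the value at tau of the expression f in tan; at the poles of tan,
   where f tau is meaningless, f is extended by continuity. *)
Definition value_by_continuity (f : R -> R) (tau w : R) : Prop :=
  (cos tau != 0 -> w = f tau) /\
  (cos tau = 0 -> f r @[r --> tau^'] --> w).

(* theta is a continuous function on R which, off the poles of tan, is a
   determination of Arctan f; two such functions differ by a constant in pi Z. *)
Definition continuous_Arctan (f theta : R -> R) : Prop :=
  continuous theta /\
  forall tau, cos tau != 0 ->
    exists k : int, theta tau = atan (f tau) + k%:~R * pi.

End Goedel.

(* Main.v *)
(* Along a geodesic t' + E y' = a, E (2 t' + E y') = b, z' = c and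
   Y = y + sqrt 2 x' / (omega b) are constant, where E = e^{sqrt 2 omega x}, so
   that geodesics solve a first-order system.  Put k^2 = (1 - ell^2) / 2,
   m^2 = (1 + ell^2) / 2 and tau = omega a m (s - v).  The null condition
   confines (rho / (2 E) - 1, omega rho (y - Y) / 2) to the circle of radius k,
   and linearises the system: X = 2 m^2 E / rho - 1 and
   W = m omega E (y - Y) satisfy dX/dtau = -2 W, dW/dtau = 2 X and
   X^2 + W^2 = k^2.  Hence (X, W) is determined by its initial value, which v
   can be adjusted to.  The resulting closed forms define a geodesic on the
   whole line, which every maximal solution must therefore fill. *)

Require Import Defs.
From mathcomp Require Import all_boot all_order all_algebra.
From mathcomp Require Import all_classical all_reals all_analysis.
From mathcomp Require Import ring lra.
Import Order.TTheory GRing.Theory Num.Theory.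
Import numFieldNormedType.Exports.
Local Open Scope classical_set_scope.
Local Open Scope ring_scope.
Set Implicit Arguments.
Unset Strict Implicit.
Unset Printing Implicit Defensive.

(** * Derivation rules in pointwise form, and constancy on intervals *)

Lemma is_derive_const (R : realType) (c s : R) : is_derive s 1 (fun=> c) 0.
Proof. exact: is_derive_cst. Qed.

Lemma is_derive_ext (R : realType) (f g : R -> R) (s d : R) :
  f =1 g -> is_derive s 1 g d -> is_derive s 1 f d.
Proof. by move=> /funext->. Qed.

Lemma is_derive_funM (R : realType) (f g : R -> R) (s df dg : R) :
  is_derive s 1 f df -> is_derive s 1 g dg ->
  is_derive s 1 (fun r => f r * g r) (df * g s + f s * dg).
Proof.
move=> hf hg; apply: (is_derive_eq (is_deriveM hf hg)).
by rewrite /GRing.scale /=; ring.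
Qed.

Lemma is_derive_funD (R : realType) (f g : R -> R) (s df dg : R) :
  is_derive s 1 f df -> is_derive s 1 g dg ->
  is_derive s 1 (fun r => f r + g r) (df + dg).
Proof. by move=> hf hg; exact: is_deriveD. Qed.

Lemma is_derive_funN (R : realType) (f : R -> R) (s df : R) :
  is_derive s 1 f df -> is_derive s 1 (fun r => - f r) (- df).
Proof. by move=> hf; exact: is_deriveN. Qed.

Lemma is_derive_funX (R : realType) (f : R -> R) (s df : R) n :
  is_derive s 1 f df ->
  is_derive s 1 (fun r => f r ^+ n) (n%:R * f s ^+ n.-1 * df).
Proof. by move=> /(is_deriveX n); rewrite exprfctE. Qed.

Lemma is_derive_funV (R : realType) (f : R -> R) (s df : R) :
  f s != 0 -> is_derive s 1 f df ->
  is_derive s 1 (fun r => (f r)^-1) (- (f s) ^- 2 * df).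
Proof. by move=> f0 hf; have := is_deriveV f0 hf. Qed.

Lemma is_derive_funcomp (R : realType) (f g : R -> R) (s df dg : R) :
  is_derive s 1 f df -> is_derive (f s) 1 g dg ->
  is_derive s 1 (fun r => g (f r)) (dg * df).
Proof. by move=> hf hg; have := is_derive1_comp hg hf; rewrite mulrC. Qed.

Lemma is_derive_interval_cst (R : realType) (I : set R) (f : R -> R) :
  is_interval I -> (forall s, I s -> is_derive s 1 f 0) ->
  forall x y, I x -> I y -> f x = f y.
Proof.
move=> itvI df0.
suff H x y : x <= y -> I x -> I y -> f x = f y.
  by move=> x y Ix Iy; have [/H->|/ltW/H->] := leP x y.
move=> xy Ix Iy.
have sub z : z \in `[x, y] -> I z.
  by rewrite in_itv /=; exact: itvI.
have [] := @MVT_segment R f (fun=> 0) x y xy.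
- by move=> z /subset_itv_oo_cc /sub; exact: df0.
- by apply: derivable_within_continuous => z /sub /df0 [+ _].
by move=> z _ /eqP; rewrite mul0r subr_eq0 => /eqP.
Qed.

(** * The metric, its inverse and its Christoffel symbols *)

(** Reduces a directional derivative to a derivative in one real variable, where the usual
    derivation rules apply. *)
Lemma partial_line (R : realType) n (f : 'rV[R]_n.+1 -> R) (i : 'I_n.+1) p :
  partial f i p = 'D_1 (fun h : R => f (h *: delta_mx ord0 i + p)) 0.
Proof.
rewrite /partial /derive; congr (lim _); do 2!f_equal; apply/funext => h /=.
by rewrite addr0 scale0r add0r /GRing.scale /= mulr1.
Qed.

(** The derivative of the coordinate x in direction [i]; the metric depends on the point through x
    alone. *)
Definition is_x {R : realType} (i : 'I_4) : R := (i == x_)%:R.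

(** The x-derivative of the metric, entry by entry. *)
Definition goedel_dmetric {R : realType} (omega : R) (p : 'rV[R]_4)
    (l j : 'I_4) : R :=
  let K := Num.sqrt 2 * omega in let E := goedel_exp omega p in
  nth 0 (nth [::]
    [:: [:: 0; 0; K * E; 0];
        [:: 0; 0; 0; 0];
        [:: K * E; 0;  K * E ^+ 2; 0];
        [:: 0; 0; 0; 0]] l) j.

Lemma goedel_exp_line (R : realType) (omega : R) (i : 'I_4) (p : 'rV[R]_4) :
  is_derive (0 : R) (1 : R) (fun h : R =>
    goedel_exp omega (h *: delta_mx ord0 i + p))
    (is_x i * (Num.sqrt 2 * omega) * goedel_exp omega p).
Proof.
have -> : (fun h : R => goedel_exp omega (h *: delta_mx ord0 i + p)) =
  fun h => expR (Num.sqrt 2 * omega * (h * is_x i + p ord0 x_)).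
  by apply/funext => h; rewrite /goedel_exp !mxE eqxx /= eq_sym.
apply: is_derive_eq; rewrite /goedel_exp /GRing.scale /=.
by rewrite mul0r add0r; ring.
Qed.

Lemma partial_goedel (R : realType) (omega : R) (l j i : 'I_4) p :
  partial (fun q => goedel_metric omega q l j) i p
  = is_x i * goedel_dmetric omega p l j.
Proof.
suff dG : is_derive (0 : R) (1 : R)
    (fun h : R => goedel_metric omega (h *: delta_mx ord0 i + p) l j)
    (is_x i * goedel_dmetric omega p l j) by rewrite partial_line derive_val.
have dE := goedel_exp_line omega i p.
have dC (c : R) : is_derive (0 : R) (1 : R) (fun=> c) (is_x i * 0).
  by rewrite mulr0; exact: is_derive_cst.
have dE2 : is_derive (0 : R) (1 : R) (fun h : R =>
  2^-1 * goedel_exp omega (h *: delta_mx ord0 i + p) ^+ 2)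
  (is_x i * (Num.sqrt 2 * omega * goedel_exp omega p ^+ 2)).
  by apply: is_derive_eq; rewrite /= scale0r add0r /GRing.scale /=; field.
rewrite -mulrA in dE.
rewrite /goedel_dmetric.
apply: (@is_derive_ext _ _ (fun h : R =>
  let E := goedel_exp omega (h *: delta_mx ord0 i + p) in
  nth 0 (nth [::]
    [:: [:: 1; 0;  E;           0];
        [:: 0; -1; 0;           0];
        [:: E; 0;  2^-1 * E ^+ 2; 0];
        [:: 0; 0;  0;           -1]] l) j)).
  by move=> h; rewrite mxE.
case: l => [] [|[|[|[|//]]]] ?; case: j => [] [|[|[|[|//]]]] ? /=;
  first [exact: dC|exact: dE|exact: dE2].
Qed.

Definition goedel_inverse {R : realType} (omega : R) (p : 'rV[R]_4) : 'M[R]_4 :=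
  let E := goedel_exp omega p in
  \matrix_(i, j) nth 0 (nth [::]
    [:: [:: -1; 0; 2 * E^-1; 0];
        [:: 0; -1; 0; 0];
        [:: 2 * E^-1; 0; - 2 * E ^- 2; 0];
        [:: 0; 0; 0; -1]] i) j.

Lemma invmx_goedel (R : realType) (omega : R) p :
  invmx (goedel_metric omega p) = goedel_inverse omega p.
Proof.
have E0 : goedel_exp omega p != 0 by rewrite gt_eqF// expR_gt0.
have gV : goedel_metric omega p *m goedel_inverse omega p = 1%:M.
  apply/matrixP => i j; rewrite !mxE !big_ord_recl big_ord0 !mxE.
  by case: i => [] [|[|[|[|//]]]] ?; case: j => [] [|[|[|[|//]]]] ? /=;
    rewrite ?mulr1n ?mulr0n; field.
have [gU _] := mulmx1_unit gV.
by rewrite -[LHS]mulmx1 -gV mulKmx.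
Qed.

(** Contracted twice with one vector, the only form in which the geodesic equation uses the symbols.
    The list is indexed by [k] in the order t, x, y, z. *)
Lemma christoffel_goedel (R : realType) (omega : R) p (v : 'rV[R]_4) k :
  let K := Num.sqrt 2 * omega in let E := goedel_exp omega p in
  \sum_(i < 4) \sum_(j < 4)
    christoffel (goedel_metric omega) p k i j * v ord0 i * v ord0 j
  = nth 0 [:: K * E * v ord0 x_ * v ord0 y_ + 2 * K * v ord0 x_ * v ord0 t_;
              K * (2^-1 * E ^+ 2 * v ord0 y_ ^+ 2 + E * v ord0 t_ * v ord0 y_);
              - 2 * K / E * v ord0 x_ * v ord0 t_;
              0] k.
Proof.
move=> K E; have E0 : E != 0 by rewrite gt_eqF// expR_gt0.
under eq_bigr do under eq_bigr do
  rewrite /christoffel invmx_goedel.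
under eq_bigr do under eq_bigr do under eq_bigr do rewrite !partial_goedel.
rewrite !big_ord_recl !big_ord0.
have -> : ord0 = t_ :> 'I_4 by exact: val_inj.
have -> : lift t_ ord0 = x_ :> 'I_4 by exact: val_inj.
have -> : lift t_ (lift ord0 ord0) = y_ :> 'I_4 by exact: val_inj.
have -> : lift t_ (lift ord0 (lift ord0 ord0)) = z_ :> 'I_4 by exact: val_inj.
have xt : is_x t_ = 0 :> R by [].
have xx : is_x x_ = 1 :> R by [].
have xy : is_x y_ = 0 :> R by [].
have xz : is_x z_ = 0 :> R by [].
rewrite !(xt, xx, xy, xz) !(mul0r, mul1r, addr0, add0r, subr0, sub0r)
  /goedel_inverse !mxE /goedel_dmetric /= -/K -/E.
case: k => [] [|[|[|[|//]]]] ? /=; field.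
all: by rewrite ?E0.
Qed.

(* The conservation laws of a, b, c and Y, solved for the velocities. *)
Definition first_integrals {R : realType} (omega a b c Y : R) (I : set R)
  (gamma : R -> 'rV[R]_4) :=
  forall s, I s ->
  let w := (goedel_exp omega (gamma s))^-1 in
  [/\ is_derive s 1 (fun r => gamma r ord0 t_) (b * w - a),
      is_derive s 1 (fun r => gamma r ord0 x_)
        (omega * b * Num.sqrt 2 / 2 * (Y - gamma s ord0 y_)),
      is_derive s 1 (fun r => gamma r ord0 y_) (w * (2 * a - b * w))
    & is_derive s 1 (fun r => gamma r ord0 z_) c].

(** * Equivalence of the geodesic equation with the first-order system *)

Lemma sqrt2_sq (R : realType) : Num.sqrt 2 * Num.sqrt 2 = 2 :> R.
Proof. by rewrite -expr2 sqr_sqrtr. Qed.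

Lemma goedel_exp_neq0 (R : realType) (omega : R) p : goedel_exp omega p != 0.
Proof. by rewrite gt_eqF// expR_gt0. Qed.

Lemma is_derive_goedel_exp (R : realType) (omega : R) (gamma : R -> 'rV[R]_4)
  (s dx : R) :
  is_derive s 1 (fun r => gamma r ord0 x_) dx ->
  is_derive s 1 (fun r => goedel_exp omega (gamma r))
    (Num.sqrt 2 * omega * dx * goedel_exp omega (gamma s)).
Proof.
move=> h; rewrite mulrC.
have H := is_derive_funM (is_derive_const (Num.sqrt 2 * omega) s) h.
rewrite mul0r add0r in H.
exact: (is_derive_funcomp H (is_derive_expR _)).
Qed.

(** By the geodesic equation a, b, c and Y have derivative 0, so they keep on the interval their
    values at [s0]. The relations t' + E y' = a and 2 t' + E y' = b / E are then solved for t' and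
    y', and the one for Y is solved for x'. *)
Lemma geodesic_first_integrals (R : realType) (omega : R) (I : set R)
  (gamma : R -> 'rV[R]_4) (s0 : R) :
  omega != 0 -> geodesic (goedel_metric omega) I gamma -> I s0 ->
  let E := goedel_exp omega (gamma s0) in
  let v := velocity gamma s0 in
  let a := v ord0 t_ + E * v ord0 y_ in
  let b := E * (2 * v ord0 t_ + E * v ord0 y_) in
  b != 0 ->
  first_integrals omega a b (v ord0 z_)
    (gamma s0 ord0 y_ + Num.sqrt 2 * v ord0 x_ / (omega * b)) I gamma.
Proof.
move=> w0 [openI itvI _ [d1 d2] geo] Is0 E0 v0 a b b0.
have D1 s i : I s -> is_derive s 1 (fun r => gamma r ord0 i)
  (velocity gamma s ord0 i).
  move=> Is; rewrite !mxE derive1E; exact/derivableP/d1.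
have D2 s i : I s -> is_derive s 1 (fun r => velocity gamma r ord0 i)
  (velocity (velocity gamma) s ord0 i).
  move=> Is; rewrite [X in is_derive _ _ _ X]mxE derive1E; exact/derivableP/d2.
pose K := Num.sqrt 2 * omega.
pose E s := goedel_exp omega (gamma s).
have DE s : I s -> is_derive s 1 E (K * velocity gamma s ord0 x_ * E s).
  by move=> Is; apply: is_derive_goedel_exp; exact: D1.
have eqs s k : I s -> velocity (velocity gamma) s ord0 k = - nth 0
    [:: K * E s * velocity gamma s ord0 x_ * velocity gamma s ord0 y_
        + 2 * K * velocity gamma s ord0 x_ * velocity gamma s ord0 t_;
        K * (2^-1 * E s ^+ 2 * velocity gamma s ord0 y_ ^+ 2
             + E s * velocity gamma s ord0 t_ * velocity gamma s ord0 y_);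
        - 2 * K / E s * velocity gamma s ord0 x_ * velocity gamma s ord0 t_;
        0] k.
  move=> Is; have /eqP := geo s Is k.
  by rewrite christoffel_goedel addr_eq0 => /eqP.
have Et s (Is : I s) := eqs s t_ Is; have Ex s (Is : I s) := eqs s x_ Is.
have Ey s (Is : I s) := eqs s y_ Is; have Ez s (Is : I s) := eqs s z_ Is.
rewrite /= in Et Ex Ey Ez.
have Ez0 s : I s -> velocity (velocity gamma) s ord0 z_ = 0.
  by move=> Is; rewrite (Ez s Is) oppr0.
have cstE (f : R -> R) :
    (forall s, I s -> is_derive s 1 f 0) -> forall s, I s -> f s = f s0.
  by move=> df s Is; exact: (is_derive_interval_cst itvI df).
have Ca := cstE
  (fun s => velocity gamma s ord0 t_ + E s * velocity gamma s ord0 y_).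
have {}Ca s : I s ->
    velocity gamma s ord0 t_ + E s * velocity gamma s ord0 y_ = a.
  apply: Ca => {}s Is; have := DE s Is; have := D2 s^~ Is => H2 HE.
  have := is_derive_funD (H2 t_) (is_derive_funM HE (H2 y_)).
  rewrite Et// Ey// => H; apply: (is_derive_eq H).
  have := goedel_exp_neq0 omega (gamma s); rewrite -/(E s) => Es.
  by rewrite -/K; field.
have Cb := cstE (fun s => E s *
  (2 * velocity gamma s ord0 t_ + E s * velocity gamma s ord0 y_)).
have {}Cb s : I s -> E s *
    (2 * velocity gamma s ord0 t_ + E s * velocity gamma s ord0 y_) = b.
  apply: Cb => {}s Is; have := DE s Is; have := D2 s^~ Is => H2 HE.
  have := is_derive_funM HE (is_derive_funD
    (is_derive_funM (is_derive_const 2 s) (H2 t_)) (is_derive_funM HE (H2 y_))).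
  rewrite Et// Ey// => H; apply: (is_derive_eq H).
  have := goedel_exp_neq0 omega (gamma s); rewrite -/(E s) => Es.
  by rewrite -/K /=; field.
have Cc s : I s -> velocity gamma s ord0 z_ = v0 ord0 z_.
  by apply: (cstE (fun s => velocity gamma s ord0 z_)) => {}s Is;
    rewrite -(Ez0 s Is); exact: D2.
have CY s : I s ->
    gamma s ord0 y_ + Num.sqrt 2 * velocity gamma s ord0 x_ / (omega * b)
    = gamma s0 ord0 y_ + Num.sqrt 2 * v0 ord0 x_ / (omega * b).
  apply: (cstE (fun s => gamma s ord0 y_
    + Num.sqrt 2 * velocity gamma s ord0 x_ / (omega * b))) => {}s Is.
  have := D2 s^~ Is => H2.
  have := is_derive_funD (D1 s y_ Is) (is_derive_funM
    (is_derive_funM (is_derive_const (Num.sqrt 2) s) (H2 x_))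
    (is_derive_const (omega * b)^-1 s)).
  rewrite Ex// => H; apply: (is_derive_eq H).
  have Es := goedel_exp_neq0 omega (gamma s); rewrite -/(E s) in Es.
  (* With [b] read at [s] instead of [s0], the x-equation becomes x'' = - (K / 2) b y'. Since sqrt 2
     * K = 2 omega, the second term of Y' is - y'. *)
  rewrite -(Cb s Is) in b0 *; rewrite /K /=.
  move: b0; rewrite mulf_eq0 negb_or => /andP[_ b0].
  have q2 := sqrt2_sq R.
  field: q2.
  by rewrite b0 Es w0.
move=> s Is w; rewrite -/(E s) in w *.
have Es := goedel_exp_neq0 omega (gamma s); rewrite -/(E s) in Es.
split.
- apply: (is_derive_eq (D1 s t_ Is)).
  by rewrite -(Ca s Is) -(Cb s Is) /w; field.
- apply: (is_derive_eq (D1 s x_ Is)).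
  have q2 := sqrt2_sq R.
  rewrite -(CY s Is); field: q2.
  by rewrite b0 w0.
- apply: (is_derive_eq (D1 s y_ Is)).
  by rewrite -(Ca s Is) -(Cb s Is) /w; field.
- by apply: (is_derive_eq (D1 s z_ Is)); exact: Cc.
Qed.

(** Differentiating the first-order system once more gives the geodesic equation, whatever the
    constants. [V] and [A] below are the resulting velocity and acceleration in coordinates. *)
Lemma first_integrals_geodesic (R : realType) (omega a b c Y : R)
  (gamma : R -> 'rV[R]_4) :
  first_integrals omega a b c Y setT gamma ->
  geodesic (goedel_metric omega) setT gamma.
Proof.
move=> D.
pose K := Num.sqrt 2 * omega.
pose E s := goedel_exp omega (gamma s).
have E0 s : E s != 0 by exact: goedel_exp_neq0.
pose V s (i : 'I_4) := nth 0 [:: b / E s - a;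
  omega * b * Num.sqrt 2 / 2 * (Y - gamma s ord0 y_);
  (E s)^-1 * (2 * a - b / E s); c] i.
have D1 (s : R) (i : 'I_4) : is_derive s 1 (fun r => gamma r ord0 i) (V s i).
  have [dt dx dy dz] := D s I.
  rewrite /V; case: i => [] [|[|[|[|//]]]] lti /=.
  - by have -> : Ordinal lti = t_ by exact: val_inj.
  - by have -> : Ordinal lti = x_ by exact: val_inj.
  - by have -> : Ordinal lti = y_ by exact: val_inj.
  - by have -> : Ordinal lti = z_ by exact: val_inj.
have vE i : (fun r => velocity gamma r ord0 i) = V^~ i.
  by apply/funext => s; rewrite mxE derive1E; exact: derive_val.
have DE (s : R) : is_derive s 1 E (K * V s x_ * E s).
  by apply: is_derive_goedel_exp; exact: D1.
have DEV s := is_derive_funV (E0 s) (DE s).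
pose A s (i : 'I_4) := nth 0 [:: - (b * K * V s x_ / E s);
  - (omega * b * Num.sqrt 2 / 2 * V s y_);
   - K * V s x_ / E s * (2 * a - 2 * b / E s); 0] i.
have D2 (s : R) (i : 'I_4) : is_derive s 1 (V^~ i) (A s i).
  rewrite /V /A; case: i => [] [|[|[|[|//]]]] ? /=.
  - have H := is_derive_funD (is_derive_funM (is_derive_const b s) (DEV s))
      (is_derive_const (- a) s).
    by apply: (is_derive_eq H); rewrite /=; field.
  - have H := is_derive_funM (is_derive_const (omega * b * Num.sqrt 2 / 2) s)
      (is_derive_funD (is_derive_const Y s) (is_derive_funN (D1 s y_))).
    by apply: (is_derive_eq H); rewrite /=; ring.
  - have H := is_derive_funM (DEV s) (is_derive_funD (is_derive_const (2 * a) s)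
      (is_derive_funN (is_derive_funM (is_derive_const b s) (DEV s)))).
    by apply: (is_derive_eq H); rewrite /=; field.
  - exact: is_derive_const.
have aE s i : velocity (velocity gamma) s ord0 i = A s i.
  by rewrite mxE vE derive1E; exact: derive_val.
split; [exact: openT| by [] | by exists 0 | split=> s _ i | ].
- by have [] := D1 s i.
- by rewrite vE; have [] := D2 s i.
move=> s _ k; rewrite christoffel_goedel aE.
have vs i : velocity gamma s ord0 i = V s i.
  by have /(congr1 (@^~ s)) := vE i.
rewrite !vs /A /V -/K -/(E s) /=.
have q2 := sqrt2_sq R.
by case: k => [] [|[|[|[|//]]]] ? /=; rewrite ?addr0 // /K; field: q2;
  rewrite E0.
Qed.

(** * Angles on the unit circle and zeros of the sine *)

Lemma cos_sin_onto (R : realType) (x y : R) : x ^+ 2 + y ^+ 2 = 1 ->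
  exists al, cos al = x /\ sin al = y.
Proof.
move=> xy.
have x1 : -1 <= x <= 1.
  by rewrite -ler_norml -(@ler_pXn2r _ 2) ?nnegrE// real_normK ?num_real//
    expr1n -xy lerDl sqr_ge0.
have sx : Num.sqrt (1 - x ^+ 2) = `|y|.
  by rewrite -xy addrAC subrr add0r sqrtr_sqr.
have [y0|/ltW y0] := leP 0 y; [exists (acos x)|exists (- acos x)].
  by rewrite acosK ?in_itv// sin_acos// sx ger0_norm.
by rewrite cosN sinN acosK ?in_itv// sin_acos// sx ler0_norm// opprK.
Qed.

(** Subtracting [floor (x / pi)] times pi keeps the sine zero and lands in [0, pi[, where only 0 is
    a zero. *)
Lemma sin_eq0_pi (R : realType) (x : R) :
  sin x = 0 -> exists k : int, x = k%:~R * pi.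
Proof.
move=> sx; exists (Num.floor (x / pi)).
have pi0 : 0 < pi :> R by exact: pi_gt0.
have sk (k : int) y : sin y = 0 -> sin (y + k%:~R * pi) = 0 :> R.
  have sn (n : nat) (z : R) : sin z = 0 -> sin (z + n%:R * pi) = 0.
    by move=> z0; rewrite mulr_natl (@alternatingn _ _ _ pi (@sinDpi R)) z0
      mulr0.
  case: k => n y0; first exact: sn.
  rewrite NegzE mulrNz mulNr; set z := y - _.
  have : sin (z + n.+1%:R * pi) = 0 by rewrite /z subrK.
  by rewrite mulr_natl (@alternatingn _ _ _ pi (@sinDpi R)) => /eqP;
    rewrite mulf_eq0 signr_eq0 /= => /eqP.
set f := Num.floor _.
have f1 : f%:~R * pi <= x by rewrite -ler_pdivlMr// floor_le_tmp.
have f2 : x < f%:~R * pi + pi.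
  by rewrite -[X in _ + X]mul1r -mulrDl -ltr_pdivrMr// -intrD1 floorD1_gt.
have := sk (- f) x sx; rewrite mulrNz mulNr => sr.
have [r0|r0] := eqVneq (x - f%:~R * pi) 0.
  by apply/eqP; rewrite -subr_eq0 r0.
have : 0 < sin (x - f%:~R * pi).
  by apply: sin_gt0_pi; rewrite lt0r r0 subr_ge0 f1 /= ltrBlDl.
by rewrite sr ltxx.
Qed.

(** * Pole-free trigonometric functions of the parameter tau *)

Section Phase.
Context {R : realType} (k m : R).
Hypothesis km1 : k ^+ 2 + m ^+ 2 = 1.
Hypothesis lekm : k ^+ 2 <= m ^+ 2.
Hypothesis m0 : 0 < m.

(* With T = m tan tau + k: phase_den = cos^2 (1 + T^2) and
   phase_num = k cos^2 (T^2 - 1), without poles.  Moreover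
   phase_cos + i phase_sin = (cos tau + i (m sin tau + k cos tau)) e^{-i tau}
   has argument Arctan T - tau modulo pi, and its real part is positive, so that
   phase_angle is a continuous determination of Arctan T. *)
Definition phase_den (tau : R) :=
  cos tau ^+ 2 + (m * sin tau + k * cos tau) ^+ 2.
Definition phase_num (tau : R) :=
  k * ((m * sin tau + k * cos tau) ^+ 2 - cos tau ^+ 2).
Definition phase_cos (tau : R) :=
  cos tau ^+ 2 + m * sin tau ^+ 2 + k * sin tau * cos tau.
Definition phase_sin (tau : R) :=
  (m - 1) * sin tau * cos tau + k * cos tau ^+ 2.
Definition phase_angle (tau : R) := tau + atan (phase_sin tau / phase_cos tau).

Let m_neq0 : m != 0. Proof. by rewrite gt_eqF. Qed.
Let m2E : m ^+ 2 = 1 - k ^+ 2. Proof. by rewrite -km1 addrC addKr. Qed.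

Lemma phase_den_gt0 tau : 0 < phase_den tau.
Proof.
rewrite lt0r addr_ge0 ?sqr_ge0// andbT paddr_eq0 ?sqr_ge0//.
apply/negP => /andP[]; rewrite !sqrf_eq0 => /eqP c0.
rewrite c0 mulr0 addr0 mulf_eq0 (negbTE m_neq0) /= => /eqP s0.
by have := cos2Dsin2 tau; rewrite c0 s0 expr0n addr0 => /eqP;
  rewrite eq_sym oner_eq0.
Qed.

(** This is X^2 + W^2 = k^2 for X = [phase_den] - 1 and W = [phase_num] / m, since 1 - m^2 = k^2. *)
Lemma phase_circle tau :
  phase_num tau ^+ 2
  = m ^+ 2 * (2 * phase_den tau - m ^+ 2 - phase_den tau ^+ 2).
Proof.
have c2 := cos2sin2 tau; rewrite /phase_num /phase_den.
by have m2 := m2E; ring: c2 m2.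
Qed.

(** Completing the square in cos tau leaves the coefficient m - k^2 / 4 on sin^2 tau. It is
    positive, as k^2 <= m^2 and k^2 + m^2 = 1 force k^2 <= 1/2 and m >= 1/2. *)
Lemma phase_cos_gt0 tau : 0 < phase_cos tau.
Proof.
have m1 : 2^-1 <= m.
  rewrite leNgt; apply/negP => m_lt.
  have : m * m < 2^-1 * 2^-1 by apply: ltr_pM => //; exact: ltW.
  by have := km1; have := lekm; rewrite !expr2; lra.
have := cos2Dsin2 tau; rewrite /phase_cos.
set c := cos tau; set s := sin tau => cs.
have : 0 < c ^+ 2 + s ^+ 2 by rewrite cs.
have -> : c ^+ 2 + m * s ^+ 2 + k * s * c
  = (c + k * s / 2) ^+ 2 + (m - k ^+ 2 / 4) * s ^+ 2 by field.
have km : 0 < m - k ^+ 2 / 4 by have := km1; have := lekm; lra.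
have [s0|s0] := eqVneq s 0.
  by rewrite s0 !mulr0 mul0r addr0 expr0n mulr0 addr0.
move=> _; apply: ltr_wpDl; first exact: sqr_ge0.
by rewrite mulr_gt0// lt0r sqrf_eq0 s0 sqr_ge0.
Qed.

Lemma is_derive_phase_den (tau : R) :
  is_derive tau 1 phase_den (- (2 / m) * phase_num tau).
Proof.
have m2 := m2E.
have c2 : cos tau ^+ 2 = 1 - sin tau ^+ 2 by rewrite cos2sin2.
have H := is_derive_funD (is_derive_funX 2 (is_derive_cos tau))
  (is_derive_funX 2 (is_derive_funD
    (is_derive_funM (is_derive_const m tau) (is_derive_sin tau))
    (is_derive_funM (is_derive_const k tau) (is_derive_cos tau)))).
apply: (is_derive_eq H); rewrite /phase_num /=.
by field: c2 m2.
Qed.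

Lemma is_derive_phase_num (tau : R) :
  is_derive tau 1 phase_num (2 * m * (phase_den tau - 1)).
Proof.
have m2 := m2E.
have c2 : cos tau ^+ 2 = 1 - sin tau ^+ 2 by rewrite cos2sin2.
have dc := is_derive_cos tau; have ds := is_derive_sin tau.
have H := is_derive_funM (is_derive_const k tau) (is_derive_funD
  (is_derive_funX 2 (is_derive_funD (is_derive_funM (is_derive_const m tau) ds)
                     (is_derive_funM (is_derive_const k tau) dc)))
  (is_derive_funN (is_derive_funX 2 dc))).
apply: (is_derive_eq H); rewrite /phase_den /=.
by ring: c2 m2.
Qed.

(** Off the poles this is (Arctan T)' = m / (cos^2 (1 + T^2)). At every tau it follows from
    [phase_cos]^2 + [phase_sin]^2 = [phase_den], as the factor e^{-i tau} preserves the modulus. *)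
Lemma is_derive_phase_angle (tau : R) :
  is_derive tau 1 phase_angle (m / phase_den tau).
Proof.
have m2 := m2E.
have c2 : cos tau ^+ 2 = 1 - sin tau ^+ 2 by rewrite cos2sin2.
have dc := is_derive_cos tau; have ds := is_derive_sin tau.
have C0 : phase_cos tau != 0 by rewrite gt_eqF// phase_cos_gt0.
have D0 : phase_den tau != 0 by rewrite gt_eqF// phase_den_gt0.
have HC : is_derive tau 1 phase_cos
    (2 * (m - 1) * sin tau * cos tau + k * (cos tau ^+ 2 - sin tau ^+ 2)).
  have H := is_derive_funD (is_derive_funD (is_derive_funX 2 dc)
    (is_derive_funM (is_derive_const m tau) (is_derive_funX 2 ds)))
    (is_derive_funM (is_derive_funM (is_derive_const k tau) ds) dc).
  by apply: (is_derive_eq H) => /=; ring.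
have HS : is_derive tau 1 phase_sin
    ((m - 1) * (cos tau ^+ 2 - sin tau ^+ 2) - 2 * k * sin tau * cos tau).
  have H := is_derive_funD (is_derive_funM
    (is_derive_funM (is_derive_const (m - 1) tau) ds) dc)
     (is_derive_funM (is_derive_const k tau) (is_derive_funX 2 dc)).
  by apply: (is_derive_eq H) => /=; ring.
have DE : phase_cos tau ^+ 2 + phase_sin tau ^+ 2 = phase_den tau.
  by rewrite /phase_cos /phase_sin /phase_den; ring: c2 m2.
have H := is_derive_funD (is_derive_id tau 1)
  (is_derive_funcomp (is_derive_funM HS (is_derive_funV C0 HC))
  (is_derive1_atan _)).
apply: (is_derive_eq H).
have -> : 1 + (phase_sin tau / phase_cos tau) ^+ 2
    = phase_den tau / phase_cos tau ^+ 2.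
  by rewrite -DE; field.
apply: (@mulIf _ (phase_den tau)) => //; rewrite divfK//.
transitivity (phase_den tau
  + ((m - 1) * (cos tau ^+ 2 - sin tau ^+ 2) - 2 * k * sin tau * cos tau)
    * phase_cos tau
  - phase_sin tau * (2 * (m - 1) * sin tau * cos tau
                     + k * (cos tau ^+ 2 - sin tau ^+ 2))).
  by field; rewrite C0 D0.
by rewrite /phase_cos /phase_sin /phase_den; ring: c2 m2.
Qed.

Lemma continuous_Arctan_phase_angle :
  continuous_Arctan (fun tau => m * tan tau + k) phase_angle.
Proof.
split=> [tau|tau c0].
  apply: differentiable_continuous; apply/derivable1_diffP.
  by have [] := is_derive_phase_angle tau.
set T := m * tan tau + k.
(* Two angles whose difference has sine 0 differ by a multiple of pi. *)
suff : sin (phase_angle tau - atan T) = 0.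
  by move=> /sin_eq0_pi[j E]; exists j; rewrite -E addrC subrK.
have C0 : phase_cos tau != 0 by rewrite gt_eqF// phase_cos_gt0.
have sin_atan (x : R) : sin (atan x) = x * cos (atan x).
  rewrite -[X in X * _]atanK /tan divfK//.
  by rewrite cos_atan invr_eq0 sqrtr_eq0 -ltNge ltr_pwDl// sqr_ge0.
rewrite /phase_angle sinB sinD cosD !sin_atan.
set A := cos (atan _); set B := cos (atan _); rewrite /T /tan.
have c2 : cos tau ^+ 2 = 1 - sin tau ^+ 2 by rewrite cos2sin2.
(* Put w = cos tau + i (m sin tau + k cos tau) and p = [phase_cos] + i [phase_sin], so that p e^{i
   tau} = w. The bracket is the imaginary part of p e^{i tau} times the conjugate of w, that is of
   |w|^2, hence 0. *)
transitivity (A * B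
  * (sin tau * (cos tau * phase_cos tau
                + phase_sin tau * (m * sin tau + k * cos tau))
     + cos tau * (phase_sin tau * cos tau
                  - phase_cos tau * (m * sin tau + k * cos tau)))
  / (phase_cos tau * cos tau)).
  by field; rewrite C0 c0.
apply/eqP; rewrite !mulf_eq0; apply/orP; left; apply/orP; right.
by apply/eqP; rewrite /phase_cos /phase_sin; ring: c2.
Qed.

(** With al = 2 tau, ([phase_den] - 1, [phase_num] / m) is k times the image of (cos al, sin al)
    under the rotation with rows (k, m) and (-m, k). For k != 0 the inverse rotation yields al; for
    k = 0 the circle is a point and tau = 0 serves. *)
Lemma phase_onto (x y : R) : x ^+ 2 + y ^+ 2 = k ^+ 2 ->
  exists tau, phase_den tau = 1 + x /\ phase_num tau = m * y.
Proof.
move=> xyk; have m2 := m2E.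
have [k0|k0] := eqVneq k 0.
  have : x ^+ 2 + y ^+ 2 == 0 by rewrite xyk k0 expr0n.
  rewrite paddr_eq0 ?sqr_ge0// !sqrf_eq0 => /andP[/eqP-> /eqP->].
  exists 0; rewrite /phase_den /phase_num k0 sin0 cos0.
  by split; ring.
have [|al [ca sa]] := @cos_sin_onto R ((k * x - m * y) / k)
  ((m * x + k * y) / k).
  transitivity ((k ^+ 2 + m ^+ 2) * (x ^+ 2 + y ^+ 2) / k ^+ 2); first by field.
  by rewrite xyk km1 mul1r divff// expf_neq0.
exists (al / 2).
have := cos2Dsin2 (al / 2).
have := cosD (al / 2) (al / 2); have := sinD (al / 2) (al / 2).
rewrite -splitr ca sa /phase_den /phase_num.
set c := cos _; set s := sin _ => sE cE cs.
have X : x = k * (c * c - s * s) * k + m * (s * c + c * s) * k.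
  by rewrite -cE -sE; field: m2.
have Y : y = k * (s * c + c * s) * k - m * (c * c - s * s) * k.
  by rewrite -cE -sE; field: m2.
have c2 : c ^+ 2 = 1 - s ^+ 2 by rewrite -cs addrK.
rewrite X Y; split; ring: c2 m2.
Qed.
End Phase.

(** * Uniqueness for the linear system, and continuous extension over the poles of tan *)

(** The system rotates (f, g), so f^2 + g^2 is conserved. It is applied to the difference of two
    solutions. *)
Lemma harmonic_unique (R : realType) (I : set R) (la : R) (f g : R -> R)
  (s0 : R) :
  is_interval I -> I s0 ->
  (forall s, I s -> is_derive s 1 f (- la * g s)) ->
  (forall s, I s -> is_derive s 1 g (la * f s)) ->
  f s0 = 0 -> g s0 = 0 -> forall s, I s -> f s = 0 /\ g s = 0.
Proof.
move=> itvI Is0 df dg f0 g0 s Is.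
have : f s ^+ 2 + g s ^+ 2 = f s0 ^+ 2 + g s0 ^+ 2.
  apply: (@is_derive_interval_cst _ I (fun s => f s ^+ 2 + g s ^+ 2)) =>
    // r Ir.
  have H := is_derive_funD (is_derive_funX 2 (df r Ir))
    (is_derive_funX 2 (dg r Ir)).
  by apply: (is_derive_eq H) => /=; ring.
rewrite f0 g0 expr0n addr0 => /eqP.
by rewrite paddr_eq0 ?sqr_ge0// !sqrf_eq0 => /andP[/eqP-> /eqP->].
Qed.

(** A continuous [g] equal to [f] off the poles supplies the extension, because the zeros of cos are
    isolated. *)
Lemma value_by_continuity_intro (R : realType) (f g : R -> R) (tau : R) :
  {for tau, continuous g} -> (forall r, cos r != 0 -> f r = g r) ->
  value_by_continuity f tau (g tau).
Proof.
move=> cg fg; split=> [/fg->//|c0].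
have : g r @[r --> tau^'] --> g tau.
  by apply: cvg_trans cg; apply: cvg_app; exact: nbhs_dnbhs.
apply: cvg_trans; apply: near_eq_cvg; near=> r.
apply/esym/fg.
(* At a zero tau of cos, cos r = - sin (r - tau) sin tau, which is nonzero for 0 < |r - tau| <
   pi. *)
have -> : r = (r - tau) + tau by rewrite subrK.
rewrite cosD c0 mulr0 sub0r oppr_eq0 mulf_neq0//; last first.
  have := cos2Dsin2 tau; rewrite c0 expr0n add0r => /eqP s1.
  by rewrite -sqrf_eq0 (eqP s1) oner_eq0.
have : r != tau by near: r; exact: nbhs_dnbhs_neq.
have : `|r - tau| < pi.
  near: r; apply: nbhs_dnbhs; apply/nbhs_ballP; exists pi => [|r] /=;
    first exact: pi_gt0.
  by rewrite /ball /= distrC.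
rewrite ltr_norml neq_lt => /andP[r1 r2] /orP[r0|r0].
  by rewrite lt_eqF// -oppr_gt0 -sinN sin_gt0_pi// oppr_gt0 subr_lt0 r0 ltrNl.
by rewrite gt_eqF// sin_gt0_pi// subr_gt0 r0.
Unshelve. all: by end_near. Qed.

(** * The null condition as a circle *)

(** Completing the square in t' makes the conserved quantity a = t' + E y' appear. *)
Lemma goedel_quadratic_form (R : realType) (omega : R) p (v : 'rV[R]_4) :
  let E := goedel_exp omega p in
  \sum_(i < 4) \sum_(j < 4) goedel_metric omega p i j * v ord0 i * v ord0 j
  = (v ord0 t_ + E * v ord0 y_) ^+ 2 - v ord0 x_ ^+ 2
    - 2^-1 * (E * v ord0 y_) ^+ 2 - v ord0 z_ ^+ 2.
Proof.
move=> E; rewrite !big_ord_recl !big_ord0 !mxE -/E /=.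
have -> : lift ord0 ord0 = x_ :> 'I_4 by exact: val_inj.
have -> : lift ord0 (lift ord0 ord0) = y_ :> 'I_4 by exact: val_inj.
have -> : lift ord0 (lift ord0 (lift ord0 ord0)) = z_ :> 'I_4 by exact: val_inj.
have -> : ord0 = t_ :> 'I_4 by exact: val_inj.
by field.
Qed.

Lemma is_derive_velocity (R : realType) n (gamma : R -> 'rV[R]_n.+1) (s : R) i
  (d : R) :
  is_derive s 1 (fun r => gamma r ord0 i) d -> velocity gamma s ord0 i = d.
Proof. by move=> h; rewrite mxE derive1E; exact: derive_val. Qed.

(** Once the velocities are replaced by the first integrals, with b = rho a and c = ell a, the null
    condition divided by 2 a^2 is the circle equation. *)
Lemma lightlike_first_integrals (R : realType) (omega ell rho Y : R)
    (I : set R) (gamma : R -> 'rV[R]_4) (s0 : R) :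
  0 < omega -> 0 < rho -> lightlike_geodesic (goedel_metric omega) I gamma ->
  I s0 -> impact_parameter omega gamma s0 = (ell, rho, Y) ->
  exists2 a : R, a != 0 &
    first_integrals omega a (rho * a) (ell * a) Y I gamma /\
    forall s, I s ->
      (rho / 2 * (goedel_exp omega (gamma s))^-1 - 1) ^+ 2
      + (omega * rho / 2 * (gamma s ord0 y_ - Y)) ^+ 2 = (1 - ell ^+ 2) / 2.
Proof.
move=> w0 r0 [geo light] Is0; rewrite /impact_parameter.
set v := velocity gamma s0; set E := goedel_exp omega (gamma s0).
set a := v ord0 t_ + _; set b := E * _ => -[ellE rhoE YE].
(* If a = 0 then rho = b / 0 = 0. *)
have a0 : a != 0.
  by apply: contraL r0 => /eqP a0; rewrite -rhoE a0 invr0 mulr0 ltxx.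
have bE : b = rho * a by rewrite -rhoE divfK.
have cE : v ord0 z_ = ell * a by rewrite -ellE divfK.
have b0 : b != 0 by rewrite bE mulf_neq0// gt_eqF.
have FI : first_integrals omega a b (v ord0 z_)
    (gamma s0 ord0 y_ + Num.sqrt 2 * v ord0 x_ / (omega * b)) I gamma.
  exact: (geodesic_first_integrals (lt0r_neq0 w0) geo Is0 b0).
rewrite YE cE bE in FI.
exists a => //; split=> // s Is.
have [_] := light s Is; rewrite goedel_quadratic_form.
have [/is_derive_velocity-> /is_derive_velocity-> /is_derive_velocity->
  /is_derive_velocity->] := FI s Is.
have E0 := goedel_exp_neq0 omega (gamma s).
set e := goedel_exp omega (gamma s) in E0 *; set y := gamma s ord0 y_.
move=> H; have q2 := sqrt2_sq R.
have r1 : rho != 0 by rewrite gt_eqF.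
apply/eqP; rewrite -subr_eq0; apply/eqP.
transitivity (- 0 / (2 * a ^+ 2)); last by rewrite oppr0 mul0r.
by rewrite -H; field: q2; rewrite a0 E0.
Qed.

(** * The explicit solution and its uniqueness *)

Section Solution.
Context {R : realType} (omega ell rho Y a k m : R).
Hypothesis w0 : 0 < omega.
Hypothesis r0 : 0 < rho.
Hypothesis a0 : a != 0.
Hypothesis m0 : 0 < m.
Hypothesis kE : k ^+ 2 = (1 - ell ^+ 2) / 2.
Hypothesis mE : m ^+ 2 = (1 + ell ^+ 2) / 2.

Let K := omega * a * m.

(** The claimed closed forms without poles, with E = rho [phase_den] / (2 m^2) solved for x; [v] is
    the affine parameter at which tau = 0. *)
Definition phase_curve (v Z0 T0 s : R) : 'rV[R]_4 :=
  let tau := K * (s - v) in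
  \row_i nth 0
    [:: T0 - tau / (omega * m) + 2 / omega * phase_angle k m tau;
        ln (rho * phase_den k m tau / (2 * m ^+ 2)) / (Num.sqrt 2 * omega);
        Y + 2 / (omega * rho) * (phase_num k m tau / phase_den k m tau);
        Z0 + ell * tau / (omega * m)] i.

Let km1 : k ^+ 2 + m ^+ 2 = 1. Proof. by rewrite kE mE; field. Qed.
Let lekm : k ^+ 2 <= m ^+ 2.
Proof. by have := sqr_ge0 ell; rewrite kE mE; lra. Qed.
Let w_neq0 : omega != 0. Proof. by rewrite gt_eqF. Qed.
Let r_neq0 : rho != 0. Proof. by rewrite gt_eqF. Qed.
Let m_neq0 : m != 0. Proof. by rewrite gt_eqF. Qed.
Let q_neq0 : Num.sqrt 2 != 0 :> R. Proof. by rewrite gt_eqF// sqrtr_gt0. Qed.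
Let D_neq0 tau : phase_den k m tau != 0.
Proof. by rewrite gt_eqF// (phase_den_gt0 _ m0). Qed.

Lemma goedel_exp_phase_curve v Z0 T0 s :
  goedel_exp omega (phase_curve v Z0 T0 s)
  = rho * phase_den k m (K * (s - v)) / (2 * m ^+ 2).
Proof.
rewrite /goedel_exp !mxE /= mulrC divfK ?mulf_neq0// lnK// posrE.
by rewrite divr_gt0// mulr_gt0// ?exprn_gt0// (phase_den_gt0 _ m0).
Qed.

Let dtau (v s : R) : is_derive s 1 (fun s => K * (s - v)) K.
Proof.
have H := is_derive_funM (is_derive_const K s)
  (is_derive_funD (is_derive_id s 1) (is_derive_const (- v) s)).
by apply: (is_derive_eq H) => /=; ring.
Qed.

Lemma phase_curve_first_integrals v Z0 T0 :
  first_integrals omega a (rho * a) (ell * a) Y setT (phase_curve v Z0 T0).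
Proof.
move=> s _ /=; rewrite goedel_exp_phase_curve.
have q2 := sqrt2_sq R.
set tau := K * (s - v).
have D0 := D_neq0 tau.
have DD := is_derive_funcomp (dtau v s) (is_derive_phase_den km1 m0
  (K * (s - v))).
have DN := is_derive_funcomp (dtau v s) (is_derive_phase_num km1 (K * (s - v))).
have DT := is_derive_funcomp (dtau v s) (is_derive_phase_angle km1 lekm m0
  (K * (s - v))).
have DV := @is_derive_funV _ (fun r => phase_den k m (K * (r - v))) s _
  (D_neq0 _) DD.
split.
- apply: (@is_derive_ext _ _ (fun s => T0 - K * (s - v) * (omega * m)^-1
    + 2 / omega * phase_angle k m (K * (s - v)))).
    by move=> r; rewrite mxE.
  have H := is_derive_funD (is_derive_funD (is_derive_const T0 s)
    (is_derive_funN (is_derive_funM (dtau v s)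
    (is_derive_const (omega * m)^-1 s))))
    (is_derive_funM (is_derive_const (2 / omega) s) DT).
  apply: (is_derive_eq H) => /=; rewrite -/tau /K; field.
  by rewrite w_neq0 r_neq0 m_neq0 D0.
- apply: (@is_derive_ext _ _ (fun s => ln
    (rho / (2 * m ^+ 2) * phase_den k m (K * (s - v))) *
    (Num.sqrt 2 * omega)^-1)).
    by move=> r; rewrite mxE /= mulrAC.
  have P : 0 < rho / (2 * m ^+ 2) * phase_den k m (K * (s - v)).
    by rewrite mulr_gt0 ?divr_gt0// ?mulr_gt0 ?exprn_gt0// (phase_den_gt0 _ m0).
  have H := is_derive_funM (is_derive_funcomp
    (is_derive_funM (is_derive_const (rho / (2 * m ^+ 2)) s) DD)
    (is_derive1_ln P)) (is_derive_const (Num.sqrt 2 * omega)^-1 s).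
  apply: (is_derive_eq H) => /=; rewrite mxE -/tau /K /=; field: q2.
  by rewrite w_neq0 r_neq0 m_neq0 D0 q_neq0.
- apply: (@is_derive_ext _ _ (fun s => Y + 2 / (omega * rho) *
    (phase_num k m (K * (s - v)) * (phase_den k m (K * (s - v)))^-1))).
    by move=> r; rewrite mxE.
  have H := is_derive_funD (is_derive_const Y s)
    (is_derive_funM (is_derive_const (2 / (omega * rho)) s)
    (is_derive_funM DN DV)).
  apply: (is_derive_eq H) => /=; rewrite -/tau /K.
  (* Differentiating the quotient produces [phase_num]^2, which the circle relation turns into a
     polynomial in [phase_den]. *)
  have N2 := phase_circle km1 tau.
  field: N2.
  by rewrite w_neq0 r_neq0 m_neq0 D0.
- apply: (@is_derive_ext _ _ (fun s => Z0 + (ell / (omega * m)) *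
    (K * (s - v)))).
    by move=> r; rewrite mxE /= mulrAC.
  have H := is_derive_funD (is_derive_const Z0 s)
    (is_derive_funM (is_derive_const (ell / (omega * m)) s) (dtau v s)).
  apply: (is_derive_eq H) => /=; rewrite /K; field.
  by rewrite w_neq0 m_neq0.
Qed.

(** On the circle, E and E (y - Y) obey an affine system with the same coefficients as the phase
    functions, so equality at [s0] propagates. This fixes x and y; t and z follow by integration, up
    to T0 and Z0. *)
Lemma first_integrals_phase_curve (I : set R) (gamma : R -> 'rV[R]_4) (s0 : R) :
  is_interval I -> I s0 ->
  first_integrals omega a (rho * a) (ell * a) Y I gamma ->
  (forall s, I s ->
      (rho / 2 * (goedel_exp omega (gamma s))^-1 - 1) ^+ 2
      + (omega * rho / 2 * (gamma s ord0 y_ - Y)) ^+ 2 = k ^+ 2) ->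
  exists v Z0 T0, forall s, I s -> gamma s = phase_curve v Z0 T0 s.
Proof.
move=> itvI Is0 FI circ.
pose E s := goedel_exp omega (gamma s); pose y (s : R) : R := gamma s ord0 y_.
have E0 s : E s != 0 by exact: goedel_exp_neq0.
have z2 s : I s -> (y s - Y) ^+ 2
    = 4 / (omega * rho) ^+ 2 * (k ^+ 2 - (rho / 2 / E s - 1) ^+ 2).
  move=> Is; rewrite -(circ s Is) -/(E s) -/(y s); field.
  by rewrite E0 w_neq0 r_neq0.
have m2 : m ^+ 2 = 1 - k ^+ 2 by rewrite -km1 addrC addKr.
(* [tau0] is the phase of the initial point (X, W) of the curve on the circle of radius k. *)
have [|tau0 [D0 N0]] := @phase_onto R k m km1
    (2 * m ^+ 2 * E s0 / rho - 1) (m * omega * E s0 * (y s0 - Y)).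
  rewrite [in X in _ + X]exprMn z2//; field: m2.
  by rewrite E0 w_neq0 r_neq0.
have K0 : K != 0 by rewrite !mulf_neq0.
set v := s0 - tau0 / K; pose tau s := K * (s - v).
have tauE : tau s0 = tau0.
  by rewrite /tau /v opprB addrC subrK mulrCA divff// mulr1.
(* [f] and [g] are the deviations of X and W from their values on the phase curve; both vanish at
   [s0] by the choice of [v]. *)
pose f s := 2 * m ^+ 2 / rho * E s - phase_den k m (tau s).
pose g s := m * omega * (E s * (y s - Y)) - m^-1 * phase_num k m (tau s).
have DD s := is_derive_funcomp (dtau v s)
  (is_derive_phase_den km1 m0 (K * (s - v))).
have DN s := is_derive_funcomp (dtau v s)
  (is_derive_phase_num km1 (K * (s - v))).
have df s : I s -> is_derive s 1 f (- (2 * K) * g s).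
  move=> Is; have [_ dx _ _] := FI s Is.
  have H := is_derive_funD (is_derive_funM
    (is_derive_const (2 * m ^+ 2 / rho) s)
    (is_derive_goedel_exp omega dx)) (is_derive_funN (DD s)).
  have q2 := sqrt2_sq R.
  apply: (is_derive_eq H); rewrite /g -/(E s) -/(tau s) -/(y s) /K /=;
    field: q2.
  by rewrite r_neq0 m_neq0.
have dg s : I s -> is_derive s 1 g (2 * K * f s).
  move=> Is; have [_ dx dy _] := FI s Is.
  have H := is_derive_funD (is_derive_funM (is_derive_const (m * omega) s)
    (is_derive_funM (is_derive_goedel_exp omega dx)
      (is_derive_funD dy (is_derive_const (- Y) s))))
    (is_derive_funN (is_derive_funM (is_derive_const m^-1 s) (DN s))).
  have q2 := sqrt2_sq R.
  apply: (is_derive_eq H); rewrite /f -/(E s) -/(tau s) -/(y s) /=.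
  (* The derivative of E (y - Y) contains (y - Y)^2; replacing it by [z2] leaves an expression
     affine in E. *)
  transitivity (m * omega * a
    * (- omega ^+ 2 * rho * E s * (y s - Y) ^+ 2 + 2 - rho / E s)
    - 2 * (phase_den k m (tau s) - 1) * K).
    by rewrite /K; field: q2; rewrite m_neq0 E0.
  rewrite z2// /K; field: m2.
  by rewrite r_neq0 E0 w_neq0.
have fg s : I s -> f s = 0 /\ g s = 0.
  apply: (harmonic_unique itvI Is0 df dg).
    by rewrite /f tauE D0; field.
  by rewrite /g tauE N0; field.
have EE s : I s -> E s = rho * phase_den k m (tau s) / (2 * m ^+ 2).
  move=> Is; have [/eqP + _] := fg s Is; rewrite subr_eq0 => /eqP <-.
  by field; rewrite m_neq0 r_neq0.
have yE s : I s -> y s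
    = Y + 2 / (omega * rho) * (phase_num k m (tau s) / phase_den k m (tau s)).
  move=> Is; have [_ /eqP] := fg s Is; rewrite subr_eq0 (EE s Is) => /eqP H.
  have -> : phase_num k m (tau s) = m * (m^-1 * phase_num k m (tau s)).
    by rewrite mulVKf.
  rewrite -H; field.
  by rewrite w_neq0 r_neq0 m_neq0 D_neq0.
(* The derivatives of t and z involve only E and constants, so these coordinates differ from those
   of [d0] by constants, which become T0 and Z0. *)
pose d0 := phase_curve v 0 0.
have FI0 := phase_curve_first_integrals v 0 0.
have E0E s : I s -> goedel_exp omega (d0 s) = E s.
  by move=> Is; rewrite goedel_exp_phase_curve EE.
have cst i :
    (forall s, I s -> is_derive s 1 (fun r => gamma r ord0 i - d0 r ord0 i) 0) ->
    forall s, I s ->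
    gamma s ord0 i = gamma s0 ord0 i - d0 s0 ord0 i + d0 s ord0 i.
  move=> H s Is; apply/eqP; rewrite -subr_eq; apply/eqP.
  exact: (is_derive_interval_cst itvI H).
have tE := cst t_; have zE := cst z_.
exists v, (gamma s0 ord0 z_ - d0 s0 ord0 z_),
  (gamma s0 ord0 t_ - d0 s0 ord0 t_) => s Is.
have {}tE : gamma s ord0 t_ = gamma s0 ord0 t_ - d0 s0 ord0 t_ + d0 s ord0 t_.
  apply: tE => // r Ir.
  have [dt _ _ _] := FI r Ir; have [dt0 _ _ _] := FI0 r Logic.I.
  have H := is_derive_funD dt (is_derive_funN dt0).
  by apply: (is_derive_eq H); rewrite E0E// subrr.
have {}zE : gamma s ord0 z_ = gamma s0 ord0 z_ - d0 s0 ord0 z_ + d0 s ord0 z_.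
  apply: zE => // r Ir.
  have [_ _ _ dz] := FI r Ir; have [_ _ _ dz0] := FI0 r Logic.I.
  have H := is_derive_funD dz (is_derive_funN dz0).
  by apply: (is_derive_eq H); rewrite subrr.
apply/rowP => i; rewrite [RHS]mxE -/K -/(tau s).
case: i => [] [|[|[|[|//]]]] lti /=.
- have -> : Ordinal lti = t_ by exact: val_inj.
  have d0t : d0 s ord0 t_ = 0 - tau s / (omega * m)
      + 2 / omega * phase_angle k m (tau s) by rewrite mxE.
  by rewrite tE d0t sub0r addrA.
- have -> : Ordinal lti = x_ by exact: val_inj.
  by rewrite -EE// /E /goedel_exp expRK mulrC mulKf// mulf_neq0.
- have -> : Ordinal lti = y_ by exact: val_inj.
  exact: yE.
- have -> : Ordinal lti = z_ by exact: val_inj.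
  have d0z : d0 s ord0 z_ = 0 + ell * tau s / (omega * m) by rewrite mxE.
  by rewrite zE d0z add0r.
Qed.
End Solution.

(** * Agreement with the formulas in tan tau *)

Lemma is_derive_continuous (R : realType) (f : R -> R) (s d : R) :
  is_derive s 1 f d -> {for s, continuous f}.
Proof. by move=> [df _]; exact/differentiable_continuous/derivable1_diffP. Qed.

Section ClosedForms.
Context {R : realType} (k m : R).
Hypothesis km1 : k ^+ 2 + m ^+ 2 = 1.
Hypothesis m0 : 0 < m.

Let D_neq0 tau : phase_den k m tau != 0.
Proof. by rewrite gt_eqF// (phase_den_gt0 _ m0). Qed.

(** Here sqrt 2 * k and sqrt 2 * m stand for sqrt (1 - ell^2) and sqrt (1 + ell^2). Multiplying by
    cos^2 turns the denominator into 2 [phase_den] and collapses the numerator to a multiple of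
    m^2. *)
Lemma exp_closed_form (rho tau : R) : rho != 0 ->
  value_by_continuity (fun r => 2 / rho *
      (1 - 2 * (Num.sqrt 2 * k) * (Num.sqrt 2 * m * tan r + Num.sqrt 2 * k)
         / (2 + (Num.sqrt 2 * m * tan r + Num.sqrt 2 * k) ^+ 2)))
    tau (rho * phase_den k m tau / (2 * m ^+ 2))^-1.
Proof.
move=> r0.
apply: (@value_by_continuity_intro _ _ (fun r =>
  (rho * phase_den k m r / (2 * m ^+ 2))^-1)).
  have DD := is_derive_phase_den km1 m0 tau.
  have H := is_derive_funM (is_derive_funM (is_derive_const rho tau) DD)
    (is_derive_const (2 * m ^+ 2)^-1 tau).
  have H0 : rho * phase_den k m tau * (2 * m ^+ 2)^-1 != 0.
    by rewrite !mulf_neq0// invr_neq0// mulf_neq0// expf_neq0// gt_eqF.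
  exact: (is_derive_continuous (@is_derive_funV _
    (fun r => rho * phase_den k m r * (2 * m ^+ 2)^-1) tau _ H0 H)).
move=> r c0; have q2 := sqrt2_sq R; have D0 := D_neq0 r.
have c2 := cos2sin2 r.
have m2 : m ^+ 2 = 1 - k ^+ 2 by rewrite -km1 addrC addKr.
have -> : 2 + (Num.sqrt 2 * m * tan r + Num.sqrt 2 * k) ^+ 2
    = 2 * phase_den k m r / cos r ^+ 2.
  by rewrite /phase_den /tan; field: q2.
have e : phase_den k m r - 2 * k * cos r * (m * sin r + k * cos r) = m ^+ 2.
  by rewrite /phase_den; ring: c2 m2.
transitivity (2 / rho
  * (phase_den k m r - 2 * k * cos r * (m * sin r + k * cos r))
  / phase_den k m r).
  by rewrite /tan; field: q2; rewrite D0 c0 r0.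
by rewrite e; field; rewrite D0 r0 gt_eqF.
Qed.

Lemma y_closed_form (omega rho Y tau : R) : omega != 0 -> rho != 0 ->
  value_by_continuity (fun r => Y + 2 * k / (omega * rho) *
      (1 - 4 / (2 + (Num.sqrt 2 * m * tan r + Num.sqrt 2 * k) ^+ 2)))
    tau (Y + 2 / (omega * rho) * (phase_num k m tau / phase_den k m tau)).
Proof.
move=> w0 r0.
apply: (@value_by_continuity_intro _ _
  (fun r => Y + 2 / (omega * rho) * (phase_num k m r / phase_den k m r))).
  have DV := @is_derive_funV _ (phase_den k m) tau _ (D_neq0 tau)
    (is_derive_phase_den km1 m0 tau).
  have H := is_derive_funD (is_derive_const Y tau)
    (is_derive_funM (is_derive_const (2 / (omega * rho)) tau)
     (is_derive_funM (is_derive_phase_num km1 tau) DV)).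
  exact: (is_derive_continuous H).
move=> r c0; have q2 := sqrt2_sq R; have D0 := D_neq0 r.
have -> : 2 + (Num.sqrt 2 * m * tan r + Num.sqrt 2 * k) ^+ 2
    = 2 * phase_den k m r / cos r ^+ 2.
  by rewrite /phase_den /tan; field: q2.
have -> : phase_num k m r = k * (phase_den k m r - 2 * cos r ^+ 2).
  by rewrite /phase_den /phase_num; ring.
by field; rewrite D0 c0 r0 w0.
Qed.
End ClosedForms.

(** * Choice of the constants and of the affine parameter *)

Unset Implicit Arguments.

Theorem proposition2 (R : realType) (omega : R) (homega : 0 < omega)
  (ell rho Y : R) (hell : -1 <= ell <= 1) (hrho : 0 < rho)
  (I : set R) (gamma : R -> 'rV[R]_4)
  (hgamma : lightlike_geodesic (goedel_metric omega) I gamma)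
  (s0 : R) (hs0 : I s0)
  (hB : impact_parameter omega gamma s0 = (ell, rho, Y)) :
  exists (u v Z0 T0 : R) (theta : R -> R),
    [/\ u != 0,
        continuous_Arctan
          (fun tau => Num.sqrt ((1 + ell ^+ 2) / 2) * tan tau
                      + Num.sqrt ((1 - ell ^+ 2) / 2)) theta,
        (maximal_geodesic (goedel_metric omega) I gamma ->
           forall tau, I (u * tau + v))
      & forall tau, I (u * tau + v) ->
        let x := gamma (u * tau + v) ord0 x_ in
        let y := gamma (u * tau + v) ord0 y_ in
        let z := gamma (u * tau + v) ord0 z_ in
        let t := gamma (u * tau + v) ord0 t_ in
        [/\ value_by_continuity
              (fun r =>
                 2 / rho *
                 (1 - 2 * Num.sqrt (1 - ell ^+ 2)
                        * (Num.sqrt (1 + ell ^+ 2) * tan r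
                           + Num.sqrt (1 - ell ^+ 2))
                      / (2 + (Num.sqrt (1 + ell ^+ 2) * tan r
                              + Num.sqrt (1 - ell ^+ 2)) ^+ 2)))
              tau (expR (- (Num.sqrt 2 * omega * x))),
            value_by_continuity
              (fun r =>
                 Y + Num.sqrt (2 * (1 - ell ^+ 2)) / (omega * rho) *
                 (1 - 4 / (2 + (Num.sqrt (1 + ell ^+ 2) * tan r
                                + Num.sqrt (1 - ell ^+ 2)) ^+ 2)))
              tau y,
            z = Z0 + ell * tau / (omega * Num.sqrt ((1 + ell ^+ 2) / 2)),
            t = T0 - tau / (omega * Num.sqrt ((1 + ell ^+ 2) / 2))
                + 2 / omega * theta tau
          & (rho / 2 * expR (- (Num.sqrt 2 * omega * x)) - 1) ^+ 2
            + (omega * rho / 2 * (y - Y)) ^+ 2 = (1 - ell ^+ 2) / 2]].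
Proof.
have [a a0 [FI circ]] := lightlike_first_integrals homega hrho hgamma hs0 hB.
(* [Num.sqrt] is 0 on negative reals, so squaring [k] back requires ell^2 <= 1. *)
have l2 : 0 <= 1 - ell ^+ 2.
  rewrite subr_ge0 -[1](expr1n _ 2) -real_normK ?num_real//.
  by rewrite ler_pXn2r ?nnegrE// ler_norml.
have l2p : 0 < 1 + ell ^+ 2 by rewrite ltr_pwDl// sqr_ge0.
set k := Num.sqrt ((1 - ell ^+ 2) / 2); set m := Num.sqrt ((1 + ell ^+ 2) / 2).
have kE : k ^+ 2 = (1 - ell ^+ 2) / 2 by rewrite sqr_sqrtr// divr_ge0.
have mE : m ^+ 2 = (1 + ell ^+ 2) / 2 by rewrite sqr_sqrtr// divr_ge0// ltW.
have m0 : 0 < m by rewrite sqrtr_gt0 divr_gt0.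
have km1 : k ^+ 2 + m ^+ 2 = 1 by rewrite kE mE; field.
have lekm : k ^+ 2 <= m ^+ 2 by have := sqr_ge0 ell; rewrite kE mE; lra.
have w0 : omega != 0 by rewrite gt_eqF.
have r0 : rho != 0 by rewrite gt_eqF.
have m_neq0 : m != 0 by rewrite gt_eqF.
have sk : Num.sqrt (1 - ell ^+ 2) = Num.sqrt 2 * k.
  by rewrite -sqrtrM// mulrC divfK.
have sm : Num.sqrt (1 + ell ^+ 2) = Num.sqrt 2 * m.
  by rewrite -sqrtrM// mulrC divfK.
have s2k : Num.sqrt (2 * (1 - ell ^+ 2)) = 2 * k.
  by rewrite sqrtrM// sk mulrA sqrt2_sq.
rewrite sk sm s2k.
have [_ itvI _ _ _] := hgamma.1.
rewrite -kE in circ.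
have [v [Z0 [T0 gE]]] := first_integrals_phase_curve homega hrho a0 m0 kE mE
  itvI hs0 FI circ.
(* The affine change inverts tau = omega a m (s - v). *)
exists (omega * a * m)^-1, v, Z0, T0, (phase_angle k m); split.
- by rewrite invr_eq0 !mulf_neq0.
- exact: continuous_Arctan_phase_angle.
- move=> [_ maxI] tau.
  (* The phase curve is a geodesic on the whole line extending [gamma], so maximality forces [I] to
     be the line. *)
  apply: (maxI setT (phase_curve omega ell rho Y a k m v Z0 T0)) => //.
    apply: first_integrals_geodesic.
    exact: (phase_curve_first_integrals _ _ homega hrho m0 kE mE).
  by move=> s /gE.
move=> tau Itau /=.
have tauE : omega * a * m * ((omega * a * m)^-1 * tau + v - v) = tau.
  by rewrite addrK mulVKf// !mulf_neq0.
have eE : expR (- (Num.sqrt 2 * omega * gamma ((omega * a * m)^-1 * tau + v)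
  ord0 x_)) = (goedel_exp omega (gamma ((omega * a * m)^-1 * tau + v)))^-1.
  by rewrite expRN.
rewrite eE; split.
- rewrite gE// goedel_exp_phase_curve// tauE.
  exact: exp_closed_form.
- by rewrite gE// mxE /= tauE; exact: y_closed_form.
- by rewrite gE// mxE /= tauE.
- by rewrite gE// mxE /= tauE.
- by rewrite circ.
Qed.
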